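(* Let $(\eta_t)_{t\ge0}$ be the multi-type TASEP with $\eta_0(x)=-x$ for all $x\in\mathbb{Z}$, and let $\tilde\nu_t(b)=\min_{x\le b}\eta_t(x)$ for $b\in\mathbb{Z}$. For integers $y$ and $r_2\le r_1$, let $\mathcal{A}_{y,r_2,r_1}$ be the event that $\tilde\nu_t(r_2)=\tilde\nu_t(r_1)=y$ and $\tilde\nu_t(r_2-1)\ne y$. Then $$\mathrm{Prob}\left(\mathcal{A}_{y,r_2,r_1}\right)=\mathrm{Prob}\left(\text{in the TASEP } \eta_t \text{ the particle of type } r_2 \text{ is the } r_1\text{-leader and is located at } y\right).$$
   Context: Multi-type TASEP: states are maps $\eta:\mathbb{Z}\to\mathbb{Z}$, $\eta(x)$ being the type of the particle at position $x$. Each pair of neighboring sites $(x,x+1)$ carries an independent exponential clock of rate $1$; when it rings, the values at $x$ and $x+1$ are swapped if $\eta(x)>\eta(x+1)$, and nothing happens otherwise. Started from $\eta_0(x)=-x$, the map $\eta_t$ is almost surely a bijection of $\mathbb{Z}$, and $\eta_t^{-1}(i)$ is the position at time $t$ of the unique particle of type $i$. The $k$-leader at time $t$ is the right-most among the particles of types $\ge k$: the particle of type $i\ge k$ such that $\eta_t^{-1}(i)\ge\eta_t^{-1}(z)$ for all $z\ge k$. The process $\tilde\nu_t$ is a totally asymmetric voter process started from $\nu_0(x)=-x$: for each pair $(x,x+1)$, independently with rate $1$, the value at $x$ is replaced by the value at $x+1$.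
   Formalization: The right-hand side as printed fails under the stated conventions (for r_2<r_1 it is 0 while the left side can be positive); the formal version corrects the signs: the particle of type -r_2 is the (-r_1)-leader and is located at -y. *)

(* Defs.v *)
From HB Require Import structures.
From mathcomp Require Import all_boot all_order all_algebra.
From mathcomp Require Import all_classical all_reals all_analysis.

Set Implicit Arguments.
Unset Strict Implicit.
Unset Printing Implicit Defensive.

Import Order.TTheory GRing.Theory Num.Theory.
Import numFieldNormedType.Exports.

Local Open Scope classical_set_scope.
Local Open Scope ring_scope.

HB.instance Definition _ := isPointed.Build int 0.
HB.instance Definition _ := @isMeasurable.Build default_measure_display
  int discrete_measurable discrete_measurable0
  discrete_measurableC discrete_measurableU.

(* Configurations are maps [f : int -> int], [f x] being the type of the
   particle at position [x]. *)

(* The default value 0 is only used when the minimum does not exist. *)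
Definition left_min (f : int -> int) (b : int) : int :=
  xget 0 [set m | (exists2 x, x <= b & f x = m) /\
                  (forall x, x <= b -> m <= f x)].

(* [f^-1 i]; the default value 0 is only used when there is not exactly one
   particle of type [i]. *)
Definition position (f : int -> int) (i : int) : int :=
  xget 0 [set p | f @^-1` [set i] = [set p]].

Definition is_leader (f : int -> int) (k i : int) : Prop :=
  k <= i /\ forall z, k <= z -> position f z <= position f i.

Definition mutually_independent d (T : measurableType d) (R : realType)
    (P : probability T R) (I : eqType) (X : I -> T -> nat) : Prop :=
  forall (F : seq I) (B : I -> set nat), uniq F ->
    P (\bigcap_(i in [set` F]) (X i @^-1` B i)) =
    (\prod_(i <- F) P (X i @^-1` B i))%E.

(* [N x s] counts the rings, during the time interval ]0, s], of the clock of
   the pair of sites (x, x + 1); only times [s >= 0] are meaningful. *)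
Definition poisson_clocks d (T : measurableType d) (R : realType)
    (P : probability T R) (N : int -> R -> {RV P >-> nat}) : Prop :=
  [/\ \forall w \ae P, forall x,
        [/\ N x 0 w = 0%N,
            forall s t, 0 <= s -> s <= t -> (N x s w <= N x t w)%N &
            forall s, 0 <= s -> \forall u \near s^'+, N x u w = N x s w],
      forall x s t k, 0 <= s -> s < t ->
        P [set w | (N x t w - N x s w)%N = k] = (poisson_pmf (t - s) k)%:E &
      (* independence of the clocks and of their increments, jointly *)
      forall tau : nat -> R, 0 <= tau 0%N -> {homo tau : i j / (i <= j)%N >-> i <= j} ->
        mutually_independent P (fun (xi : int * nat) w =>
          (N xi.1 (tau xi.2.+1) w - N xi.1 (tau xi.2) w)%N)].

Definition rings_at (R : realType) (n : R -> nat) (s : R) : Prop :=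
  0 < s /\ forall u, 0 <= u -> u < s -> (n u < n s)%N.

Definition tasep_swap (ab : int * int) : int * int :=
  if ab.2 < ab.1 then (ab.2, ab.1) else ab.

(* The requirements are local in space because infinitely many clocks ring in
   every time interval of positive length. *)
Definition tasep_path (R : realType) (n : int -> R -> nat)
    (e : R -> int -> int) : Prop :=
  (forall x s t, 0 <= s -> s <= t ->
     (forall u, s < u -> u <= t ->
        ~ rings_at (n (x - 1)) u /\ ~ rings_at (n x) u) ->
     e t x = e s x) /\
  (forall x s, rings_at (n x) s ->
     \forall u \near s^'-,
       (e s x, e s (x + 1)) = tasep_swap (e u x, e u (x + 1))).

(* Harris' graphical construction: almost surely, for every bounded time
   interval, there are clocks arbitrarily far to the left and to the right that
   do not ring, so that the clocks and the initial configuration determine the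
   trajectory. *)
Definition multitype_tasep d (T : measurableType d) (R : realType)
    (P : probability T R) (N : int -> R -> {RV P >-> nat})
    (eta : R -> int -> {RV P >-> int}) : Prop :=
  poisson_clocks N /\
  \forall w \ae P, tasep_path (fun x s => N x s w) (fun s x => eta s x w).

(* Main.v *)
(* Multiplying permutations by adjacent transpositions only when this creates
   an inversion is an action of the 0-Hecke monoid, so reading a word of swaps
   backwards inverts the permutation it produces.  Cut [0, t] into k equal
   slices.  Up to a small probability every slice contains at most one ring in
   a large window, and some bonds far to the left and to the right stay silent;
   between two silent bonds eta_t is then given by the word of the successive
   rings.  The joint law of the increments of the clocks is invariant under
   reversal of the slices, which turns eta_t = - w into - w^-1, and the two
   events are exchanged by w <-> w^-1. *)
Require Import Defs.
From mathcomp Require Import all_boot all_order all_algebra.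
From mathcomp Require Import all_classical all_reals all_analysis.
From mathcomp Require Import zify lra ring.

Set Implicit Arguments.
Unset Strict Implicit.
Unset Printing Implicit Defensive.

Import Order.TTheory GRing.Theory Num.Theory.
Import numFieldNormedType.Exports.

Local Open Scope classical_set_scope.
Local Open Scope ring_scope.

(** * The 0-Hecke action on permutations *)

(** Time is discretized because independence of the clocks is given only along deterministic grids.
    On a regular grid the increments of each clock over the slices are independent with one common
    law, so reversing time merely reindexes a finite product and no law of ring times is needed.
    Neither event is local, since each compares infinitely many sites. Silent bonds repair this:
    particles do not cross them, so sites beyond them satisfy the required inequalities
    automatically. For the reversal to preserve them, these bonds must be read off the word of the
    window, as letters that do not occur in it, and a word and its reversal have the same letters.
    For a fixed window and grid the exchange is exact except on a set made of three pieces: a slice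
    with two rings, no silent bond found on the left, none found on the right. Each piece can be
    made arbitrarily small, and equality of the two probabilities follows by letting the errors tend
    to 0. *)

Definition transp (c x : int) : int :=
  if x == c then c + 1 else if x == c + 1 then c else x.

Lemma transpK c : involutive (transp c).
Proof.
move=> x; rewrite /transp.
by case: (eqVneq x c); case: (eqVneq x (c + 1)) => *; do ?case: ifP => *; lia.
Qed.

Lemma transp_le c a x : c != a -> (transp c x <= a) = (x <= a).
Proof.
rewrite /transp.
by case: (eqVneq x c); case: (eqVneq x (c + 1)) => *; do ?case: ifP => *; lia.
Qed.

(* A permutation is kept together with its inverse, so that inversion is the
   exchange of the two components. *)
Definition bij_pair := ((int -> int) * (int -> int))%type.

Definition mutual_inverse (p : bij_pair) := cancel p.1 p.2 /\ cancel p.2 p.1.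

Definition inv_pair (p : bij_pair) : bij_pair := (p.2, p.1).

(** The test allows the multiplication only when it creates an inversion. For the configuration
    [- p.1] it says that the type at [c] exceeds the type at [c + 1], which is the TASEP rule. *)
Definition rmul (p : bij_pair) (c : int) : bij_pair :=
  if p.1 c < p.1 (c + 1) then (p.1 \o transp c, transp c \o p.2) else p.

Definition lmul (p : bij_pair) (c : int) : bij_pair :=
  inv_pair (rmul (inv_pair p) c).

Lemma rmul_mutual_inverse p c : mutual_inverse p -> mutual_inverse (rmul p c).
Proof.
rewrite /rmul => -[pK Kp]; case: ifP => _ //; split => x /=.
  by rewrite pK transpK.
by rewrite transpK Kp.
Qed.

Lemma inv_mutual_inverse p : mutual_inverse p -> mutual_inverse (inv_pair p).
Proof. by case. Qed.

Lemma transp_lt c x y : (x, y) != (c, c + 1) -> (x, y) != (c + 1, c) ->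
  (transp c x < transp c y) = (x < y).
Proof.
rewrite !xpair_eqE /transp.
by case: (eqVneq x c); case: (eqVneq x (c + 1)); case: (eqVneq y c);
  case: (eqVneq y (c + 1)) => *; lia.
Qed.

Lemma transpL c : transp c c = c + 1. Proof. by rewrite /transp eqxx. Qed.

Lemma transpR c : transp c (c + 1) = c.
Proof. by rewrite /transp eqxx; case: ifP => *; lia. Qed.

Lemma transp_conj p i j : mutual_inverse p -> p.1 j = i -> p.1 (j + 1) = i + 1 ->
  p.1 \o transp j = transp i \o p.1.
Proof.
move=> [pK _] pj pj1; apply/funext => x /=; rewrite {1}/transp.
case: (eqVneq x j) => [->|xj]; first by rewrite pj pj1 transpL.
case: (eqVneq x (j + 1)) => [->|xj1]; first by rewrite pj pj1 transpR.
by rewrite /transp -pj1 -pj !(can_eq pK) (negPf xj) (negPf xj1).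
Qed.

(* Either [p.1] maps {j, j + 1} onto {i, i + 1}, and both sides are computed,
   or neither multiplication changes the comparison decided by the other. *)
Lemma lmul_rmulC p i j : mutual_inverse p ->
  lmul (rmul p j) i = rmul (lmul p i) j.
Proof.
move=> pp; have [pK Kp] := pp.
have pE x z : (p.1 x == z) = (p.2 z == x).
  by apply/eqP/eqP => <-; rewrite ?pK ?Kp.
rewrite /lmul /rmul /inv_pair.
have [/eqP|up] := eqVneq (p.1 j, p.1 (j + 1)) (i, i + 1).
  rewrite xpair_eqE => /andP[/eqP pj /eqP pj1].
  have [qi qi1] : p.2 i = j /\ p.2 (i + 1) = j + 1 by rewrite -pj1 -pj !pK.
  have lt1 (x : int) : (x < x + 1) = true by lia.
  have lt2 (x : int) : (x + 1 < x) = false by lia.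
  rewrite pj pj1 lt1 /= qi qi1 transpL transpR lt1 lt2 /= pj pj1.
  rewrite transpL transpR lt2 (transp_conj pp pj pj1).
  by rewrite (transp_conj (inv_mutual_inverse pp) qi qi1).
have [/eqP|down] := eqVneq (p.1 j, p.1 (j + 1)) (i + 1, i).
  rewrite xpair_eqE => /andP[/eqP pj /eqP pj1].
  have [qi qi1] : p.2 i = j + 1 /\ p.2 (i + 1) = j by rewrite -pj -pj1 !pK.
  have lt2 (x : int) : (x + 1 < x) = false by lia.
  by rewrite pj pj1 lt2 /= qi qi1 lt2 /= pj pj1 lt2.
have up' : (p.2 i, p.2 (i + 1)) != (j, j + 1).
  by move: up; rewrite !xpair_eqE !pE.
have down' : (p.2 i, p.2 (i + 1)) != (j + 1, j).
  by move: down; rewrite !xpair_eqE !pE andbC.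
have ti := transp_lt up down; have tj := transp_lt up' down'.
by case pj: (p.1 j < _); case qi: (p.2 i < _); rewrite /= ?tj ?ti ?pj ?qi /= ?pj ?qi.
Qed.

Definition word_pair (l : seq int) : bij_pair := foldl rmul (id, id) l.

Lemma word_pair_mutual_inverse l : mutual_inverse (word_pair l).
Proof.
rewrite /word_pair; have : mutual_inverse (id, id) by [].
by elim: l (id, id) => //= c l IHl p /(rmul_mutual_inverse c)/IHl.
Qed.

(** On the identity, left and right multiplication by [c] agree. Since left multiplication commutes
    with each later right multiplication, the letter [c] can be moved to the front of the word. *)
Lemma lmul_word_pair c l : lmul (word_pair l) c = word_pair (c :: l).
Proof.
rewrite /word_pair /=.
have -> : rmul (id, id) c = lmul (id, id) c by rewrite /lmul /rmul; case: ifP.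
have : mutual_inverse (id, id) by [].
elim: l (id, id) => //= b l IHl p pp.
by rewrite IHl; [rewrite lmul_rmulC | apply: rmul_mutual_inverse].
Qed.

(** A last letter acts by right multiplication. In the reversed word it comes first and acts by left
    multiplication, which is right multiplication of the inverse. *)
Lemma word_pair_rev l : word_pair (rev l) = inv_pair (word_pair l).
Proof.
elim/last_ind: l => // l c IHl; rewrite rev_rcons -lmul_word_pair IHl.
by rewrite /word_pair -cats1 foldl_cat /= /lmul /inv_pair; case: (foldl _ _ _).
Qed.

(** Only the transposition of [a] and [a + 1] moves a point across the gap between them, so a letter
    absent from the word leaves both half-lines invariant. *)
Lemma word_pair_le a l x : a \notin l -> ((word_pair l).1 x <= a) = (x <= a).
Proof.
move=> al; rewrite /word_pair; set p : bij_pair := (id, id).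
have : forall x, (p.1 x <= a) = (x <= a) by [].
elim: l p al x => [|c l IHl] p al x pa /=; first exact: pa.
move: al; rewrite inE negb_or => /andP[ac al].
apply: IHl al _ _ => z; rewrite /rmul; case: ifP => //= _.
by rewrite pa transp_le // eq_sym.
Qed.

Definition word_conf (l : seq int) (x : int) : int := - (word_pair l).1 x.

Definition swap_at (c : int) (f : int -> int) (x : int) : int :=
  if x == c then (tasep_swap (f c, f (c + 1))).1
  else if x == c + 1 then (tasep_swap (f c, f (c + 1))).2 else f x.

Lemma word_conf_rcons l c x :
  word_conf (rcons l c) x = swap_at c (word_conf l) x.
Proof.
rewrite /word_conf /word_pair -cats1 foldl_cat /=; set p := foldl _ _ _.
rewrite /swap_at /tasep_swap /rmul /= ltrN2 /transp.
by case: (ltP (p.1 c)) => _ /=; case: (eqVneq x c) => [E|_] //;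
  rewrite ?E //; case: (eqVneq x (c + 1)) => [{}E|_] //; rewrite ?E.
Qed.

(** * Configurations made of finite blocks *)

Lemma word_conf_lt a l x : a \notin l -> (word_conf l x < - a) = (a < x).
Proof. by move=> al; rewrite ltrN2 !ltNge word_pair_le. Qed.

Lemma word_conf_inj l : injective (word_conf l).
Proof.
by move=> x z /oppr_inj; apply: can_inj (word_pair_mutual_inverse l).1 x z.
Qed.

Lemma word_conf_surj l i : exists x, word_conf l x = i.
Proof.
exists ((word_pair l).2 (- i)).
by rewrite /word_conf (word_pair_mutual_inverse l).2 opprK.
Qed.

Lemma int_bounded_exists_min (A : set int) (lo : int) : A !=set0 ->
  (forall m, A m -> lo <= m) -> exists2 m, A m & forall m', A m' -> m <= m'.
Proof.
move=> [m0 Am0] Alo; pose B (k : nat) := `[< A (lo + k%:Z) >].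
have BE m : A m -> B `|m - lo|%N.
  move=> Am; apply/asboolP; have := Alo _ Am.
  by move=> le_lo; rewrite (_ : lo + _ = m) //; lia.
have [k /asboolP Ak kmin] := ex_minnP (ex_intro B _ (BE _ Am0)).
exists (lo + k%:Z) => // m Am; have := kmin _ (BE _ Am).
by have := Alo _ Am; lia.
Qed.

Lemma left_minP (f : int -> int) b m :
  (exists2 x, x <= b & f x = m) -> (forall x, x <= b -> m <= f x) ->
  left_min f b = m.
Proof.
move=> fm mf; rewrite /left_min; case: xgetP => [m' _|/(_ m) []] //.
move=> [[x xb <-] m'f]; have [z zb fz] := fm.
by have := m'f _ zb; have := mf _ xb; lia.
Qed.

Lemma positionP (f : int -> int) i p : injective f -> f p = i -> position f i = p.
Proof.
move=> finj fp; have fE : f @^-1` [set i] = [set p].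
  by apply/seteqP; split=> x /= => [|->//]; rewrite -fp => /finj.
rewrite /position; case: xgetP => [p' _|/(_ p) []] //=.
by rewrite fE => /seteqP[+ _] => /(_ p erefl).
Qed.

(* [S x] reads: the clock of (x, x + 1) has not rung. *)
Record block_conf (S : set int) (f : int -> int) : Prop := BlockConf {
  silent_left : forall K, exists2 a, a < K & S a;
  silent_right : forall K, exists2 b, K < b & S b;
  block_word : forall a b, S a -> S b -> a < b ->
    exists2 l, forall c, S c -> c \notin l &
      forall x, a < x -> x <= b -> f x = word_conf l x }.

Section BlockConf.
Variables (S : set int) (f : int -> int).
Hypothesis fS : block_conf S f.

Lemma block_conf_window K : exists a b,
  [/\ a < - K, K < b, S a & S b].
Proof.
have [a aK Sa] := silent_left fS (- K).
by have [b bK Sb] := silent_right fS K; exists a, b.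
Qed.

Lemma block_conf_wordE K : exists l, (forall c, S c -> c \notin l) /\
  forall x, - K <= x -> x <= K -> f x = word_conf l x.
Proof.
have [a [b [aK bK Sa Sb]]] := block_conf_window `|K|.
have [|l Sl fl] := block_word fS Sa Sb; first by lia.
by exists l; split=> // x xK1 xK2; apply: fl; lia.
Qed.

(** No particle crosses a silent bond, so each side of it carries the same set of types as in the
    initial configuration. *)
Lemma block_conf_lt a x : S a -> (f x < - a) = (a < x).
Proof.
move=> Sa; have [l [Sl ->]] := block_conf_wordE `|x|; try lia.
exact/word_conf_lt/Sl.
Qed.

Lemma block_conf_inj : injective f.
Proof.
move=> x z; have [l [_ fl]] := block_conf_wordE (`|x| + `|z|).
by rewrite !fl; try lia; exact: word_conf_inj.
Qed.

Lemma block_conf_surj i : exists x, f x = i.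
Proof.
have [a [b [aK bK Sa Sb]]] := block_conf_window `|i|.
have [|l Sl fl] := block_word fS Sa Sb; first by lia.
(* The word configuration agrees with [f] only on the window. The site of type [i] lies there
   because [i] is between [- b] and [- a], and [a], [b] do not occur in [l]. *)
have [x lx] := word_conf_surj l i; exists x; rewrite fl //.
  by rewrite -(word_conf_lt _ (Sl _ Sa)) lx; lia.
by rewrite leNgt -(word_conf_lt _ (Sl _ Sb)) lx; lia.
Qed.

Lemma block_conf_min b : exists m, (exists2 x, x <= b & f x = m) /\
  (forall x, x <= b -> m <= f x).
Proof.
have [c bc Sc] := silent_right fS b.
(* The half-line is infinite. A silent bond [c] to the right of [b] confines the types on it to
   values at least [- c], so the minimum is attained. *)
have [||m [x xb <-] fx] := @int_bounded_exists_min (f @` [set x | x <= b]) (- c).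
- by exists (f b), b => /=.
- by move=> m [x /= xb <-]; rewrite leNgt block_conf_lt //; lia.
exists (f x); split=> [|z zb]; first by exists x.
by apply: fx; exists z.
Qed.

End BlockConf.

Definition min_event (r2 r1 y : int) (f : int -> int) : Prop :=
  f r2 = y /\ forall x, x <= r1 -> y <= f x.

Definition leader_event (r2 r1 y : int) (f : int -> int) : Prop :=
  f (- y) = - r2 /\ forall p, - y < p -> f p < - r1.

(** The running minimum can reach [y] for the first time at [r2] only if type [y] sits there.
    Conversely, injectivity of [f] prevents [y] from also being the minimum over the sites before
    [r2]. *)
Lemma block_conf_min_event S f r2 r1 y : block_conf S f -> r2 <= r1 ->
  (left_min f r2 = y /\ left_min f r1 = y /\ left_min f (r2 - 1) <> y) <->
  min_event r2 r1 y f.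
Proof.
move=> fS r21; have finj := block_conf_inj fS; split.
  have minE b : (exists2 x, x <= b & f x = left_min f b) /\
      (forall x, x <= b -> left_min f b <= f x).
    by have [m [fm mf]] := block_conf_min fS b; rewrite (left_minP fm mf).
  move=> [nu2 [nu1 nu3]]; have [[x xr2 fx] ymin] := minE r2.
  split; last by rewrite -nu1; exact: (minE r1).2.
  case: (eqVneq x r2) => [<-|xr]; first by rewrite fx.
  case: nu3; apply: left_minP => [|z zr]; first by exists x; [lia|rewrite fx].
  by rewrite -nu2; apply: ymin; lia.
move=> [fr2 yf]; split; first by apply: left_minP => [|z zr]; [exists r2|apply: yf; lia].
split; first by apply: left_minP => //; exists r2.
have [m [[x xr fx] mf]] := block_conf_min fS (r2 - 1).
rewrite (left_minP _ mf); last by exists x.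
move=> my; have xr2 : x = r2 by apply: finj; rewrite fr2 fx.
by move: xr; rewrite xr2; lia.
Qed.

(** Since [f] is a bijection, [position f] is its inverse, and a condition on the positions of all
    types at least [- r1] becomes one on the types at all sites beyond [- y]. *)
Lemma block_conf_leader_event S f r2 r1 y : block_conf S f -> r2 <= r1 ->
  (is_leader f (- r1) (- r2) /\ position f (- r2) = - y) <->
  leader_event r2 r1 y f.
Proof.
move=> fS r21; have finj := block_conf_inj fS.
have fpos p : position f (f p) = p by exact: positionP.
have posf i : f (position f i) = i.
  by have [x <-] := block_conf_surj fS i; rewrite fpos.
split.
  move=> [[_ lead] pos]; split; first by rewrite -pos posf.
  move=> p yp; rewrite ltNge; apply/negP => /lead.
  by rewrite fpos pos; lia.
move=> [fy flt]; rewrite /is_leader -fy fpos; split=> //; split; first by lia.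
move=> z zr; rewrite leNgt; apply/negP => /flt.
by rewrite posf; lia.
Qed.

Section Transfer.
Variables (S : set int) (f : int -> int) (a b : int) (l : seq int).
Hypotheses (fS : block_conf S f) (Sa : S a) (Sb : S b).
Hypotheses (al : a \notin l) (bl : b \notin l).
Hypothesis fl : forall x, a < x -> x <= b -> f x = word_conf l x.

(** Only sites up to [r1] matter. Those in [(a, b]] carry the same types on both sides, and at those
    up to [a] every type is at least [- a], hence at least [y]. *)
Lemma min_event_word r2 r1 y : a < r2 -> r2 <= r1 -> r1 <= b -> y <= - a ->
  min_event r2 r1 y f <-> min_event r2 r1 y (word_conf l).
Proof.
move=> ar2 r21 r1b ya.
have fa x : x <= a -> (y <= f x) /\ (y <= word_conf l x).
  move=> xa; have := block_conf_lt fS x Sa.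
  by have := word_conf_lt x al; lia.
rewrite /min_event fl //; last by lia.
by split=> -[-> yf]; split=> // x xr1; have := yf _ xr1;
  (case: (leP x a) => [/fa[]//|ax]); rewrite fl //; lia.
Qed.

(** Here the uncontrolled sites lie beyond [b], where every type is below [- b] and thus below
    [- r1]. *)
Lemma leader_event_word r2 r1 y : a < - y -> - y <= b -> r1 <= b ->
  leader_event r2 r1 y f <-> leader_event r2 r1 y (word_conf l).
Proof.
move=> ay yb r1b.
have fb x : b < x -> (f x < - r1) /\ (word_conf l x < - r1).
  move=> bx; have := block_conf_lt fS x Sb.
  by have := word_conf_lt x bl; lia.
rewrite /leader_event fl //.
by split=> -[-> fr]; split=> // p yp; have := fr _ yp;
  (case: (ltP b p) => [/fb[]//|pb]); rewrite fl //; lia.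
Qed.

End Transfer.

(* The configuration of [l] is [- w] and that of [rev l] is [- w^-1]. *)
Lemma min_event_rev l r2 r1 y :
  min_event r2 r1 y (word_conf l) <-> leader_event r2 r1 y (word_conf (rev l)).
Proof.
rewrite /min_event /leader_event /word_conf word_pair_rev /=.
have [wK Kw] := word_pair_mutual_inverse l.
set w := (word_pair l).1 in wK Kw *; set w' := (word_pair l).2 in wK Kw *.
split=> -[wr wmin]; split.
- by rewrite -wr opprK wK.
- move=> p yp; rewrite ltrN2 ltNge; apply/negP => /wmin; rewrite Kw; lia.
- by have /oppr_inj <- := wr; rewrite Kw opprK.
move=> x xr; rewrite leNgt; apply/negP => lt_y.
by have := wmin (w x); rewrite wK; lia.
Qed.

(** * Trajectories between silent bonds *)

Section CountingPath.
Variables (R : realType) (n : R -> nat).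
Hypothesis n_homo : forall s t, 0 <= s -> s <= t -> (n s <= n t)%N.
Hypothesis n_rcont : forall s, 0 <= s -> \forall u \near s^'+, n u = n s.

Lemma constant_no_ring s t : 0 <= s -> n t = n s ->
  forall u, s < u -> u <= t -> ~ rings_at n u.
Proof.
move=> s0 nts u su ut [_ /(_ _ s0 su)].
by have := n_homo (le_trans s0 (ltW su)) ut; rewrite nts; lia.
Qed.

(** The ring is the infimum of the times at which the count exceeds [n s]. Right continuity makes
    this infimum attained, and a second ring would need a further unit of increment. *)
Lemma increment1_ring s t : 0 <= s -> s <= t -> n t = (n s).+1 ->
  exists u, [/\ s < u, u <= t, rings_at n u &
    forall v, s < v -> v <= t -> rings_at n v -> v = u].
Proof.
move=> s0 st nts; pose A := [set v | s <= v /\ (n s < n v)%N].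
have At : A t by split=> //; rewrite nts.
have Ainf : has_inf A by split; [exists t | exists s => v []].
have su : s <= inf A by apply: lb_le_inf; [exists t | move=> v []].
have u0 := le_trans s0 su.
have ut : inf A <= t by apply: ge_inf => //; case: Ainf.
have nu : (n s < n (inf A))%N.
  have [e /= e0 ne] := n_rcont u0.
  have [v Av vu] := inf_adherent e0 Ainf.
  have : inf A <= v by apply: ge_inf => //; case: Ainf.
  rewrite le_eqVlt => /orP[/eqP->|uv]; first by case: Av.
  rewrite -(ne v) //=; first by case: Av.
  by rewrite distrC gtr0_norm ?subr_gt0 // ltrBlDl.
have ltu v : 0 <= v -> v < inf A -> (n v <= n s)%N.
  move=> v0 vu; have [sv|vs] := leP s v; last exact/n_homo/ltW.
  rewrite leqNgt; apply/negP => nsv.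
  have : inf A <= v by apply: ge_inf => //; case: Ainf.
  by rewrite leNgt vu.
exists (inf A); split=> //.
- rewrite lt_neqAle su andbT; apply/eqP => us.
  by move: nu; rewrite -us ltnn.
- split; last by move=> v v0 vu; apply: leq_ltn_trans nu; exact: ltu.
  rewrite lt_neqAle u0 andbT; apply/eqP => us; move: nu; rewrite -us.
  have -> : s = 0 by apply/eqP; rewrite eq_le s0 us su.
  by rewrite ltnn.
move=> v sv vt [v0 vn]; have [vu|uv|//] := ltgtP v (inf A).
  by have := ltu v (ltW v0) vu; have := vn _ s0 sv; lia.
have := vn _ u0 uv; have := n_homo (ltW v0) vt; rewrite nts.
by move: nu; lia.
Qed.

End CountingPath.

Section TasepPath.
Variables (R : realType) (n : int -> R -> nat) (e : R -> int -> int).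
Hypothesis n_homo : forall x s t, 0 <= s -> s <= t -> (n x s <= n x t)%N.
Hypothesis n_rcont : forall x s, 0 <= s -> \forall u \near s^'+, n x u = n x s.
Hypothesis e_path : tasep_path n e.

Lemma path_slice_idle x s t : 0 <= s -> s <= t ->
  n (x - 1) t = n (x - 1) s -> n x t = n x s -> e t x = e s x.
Proof.
move=> s0 st n1 n2; apply: e_path.1 => // u su ut.
by split; [exact (constant_no_ring (n_homo _) s0 n1 su ut) |
  exact (constant_no_ring (n_homo _) s0 n2 su ut)].
Qed.

(** The trajectory at [c] and [c + 1] is constant on the slice before the unique ring [u] and again
    from [u] on, so the whole slice acts as a single swap. *)
Lemma path_slice_swap c s t : 0 <= s -> s <= t ->
  n c t = (n c s).+1 -> n (c - 1) t = n (c - 1) s -> n (c + 1) t = n (c + 1) s ->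
  (e t c, e t (c + 1)) = tasep_swap (e s c, e s (c + 1)).
Proof.
move=> s0 st nc nl nr.
have [u [su ut ru uniq]] := increment1_ring (n_homo c) (n_rcont c) s0 st nc.
have idle x : n x t = n x s -> forall v, s < v -> v <= t -> ~ rings_at (n x) v.
  by move=> nx; apply: constant_no_ring nx => //; exact: n_homo.
have ct v w : s <= v -> v <= w -> w <= t -> (w < u \/ u <= v) ->
    e w c = e v c /\ e w (c + 1) = e v (c + 1).
  move=> sv vw wt uvw; have v0 := le_trans s0 sv.
  have cidle z : v < z -> z <= w -> ~ rings_at (n c) z.
    move=> vz zw rz; have zu := uniq _ (le_lt_trans sv vz) (le_trans zw wt) rz.
    case: uvw => [wu|uv].
      by move: zw; rewrite zu leNgt wu.
    by move: vz; rewrite zu ltNge uv.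
  split; apply: e_path.1 => // z vz zw; rewrite ?addrK;
    have sz := le_lt_trans sv vz; have zt := le_trans zw wt.
    by split; [apply: (idle _ nl) | apply: cidle].
  by split; [apply: cidle | apply: (idle _ nr)].
have [-> ->] := ct u t (ltW su) ut (lexx t) (or_intror (lexx u)).
(* The swap rule relates time [u] only to times just before it. One such [v] inside the slice is
   enough, since the two values at [v] are those at [s]. *)
have : \forall v \near u^'-, s < v /\ v < u /\
    (e u c, e u (c + 1)) = tasep_swap (e v c, e v (c + 1)).
  near=> v; split; [|split]; near: v.
  - exact: nbhs_left_gt.
  - exact: nbhs_left_lt.
  - exact: e_path.2.
move=> /filter_ex[v [sv [vu ->]]].
by have [-> ->] := ct s v (lexx s) (ltW sv) (le_trans (ltW vu) ut) (or_introl vu).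
Unshelve. all: by end_near. Qed.

Variables (tau : nat -> R) (k : nat) (A B : int) (o : nat -> option int).
Hypothesis tau0 : tau 0%N = 0.
Hypothesis tau_homo : {homo tau : i j / (i <= j)%N >-> i <= j}.
Hypothesis oAB : forall j c, (j < k)%N -> o j = Some c -> A <= c <= B.
Hypothesis no : forall j x, (j < k)%N -> A <= x <= B ->
  (n x (tau j.+1) - n x (tau j))%N = (o j == Some x).
Hypothesis e0 : forall x, e 0 x = - x.

Definition slice_word (j : nat) : seq int := pmap o (iota 0 j).

Lemma tau_ge0 j : 0 <= tau j.
Proof. by rewrite -tau0; exact: tau_homo. Qed.

Lemma increment_slice j x : (j < k)%N -> A <= x <= B ->
  n x (tau j.+1) = (n x (tau j) + (o j == Some x))%N.
Proof.
move=> jk xAB; rewrite -no //.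
by rewrite subnKC //; apply: n_homo; [exact: tau_ge0|exact: tau_homo].
Qed.

Lemma silent_notin_slice_word c : n c (tau k) = n c 0 -> c \notin slice_word k.
Proof.
move=> Sc; rewrite /slice_word; rewrite mem_pmap; apply/mapP => -[j].
rewrite mem_iota /= add0n => jk /esym oj.
have := increment_slice jk (oAB jk oj); rewrite oj eqxx.
have := n_homo c (tau_ge0 0) (tau_homo (leq0n j)).
have := n_homo c (tau_ge0 j.+1) (tau_homo jk).
by rewrite tau0 Sc; lia.
Qed.

(** The slices are read one after another. An empty slice changes nothing and a slice with ring [c]
    appends the letter [c]; the silent bonds [a] and [b] keep out influences from outside the
    window. *)
Lemma path_slice_word a b x : A <= a -> b <= B ->
  n a (tau k) = n a 0 -> n b (tau k) = n b 0 -> a < x -> x <= b ->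
  e (tau k) x = word_conf (slice_word k) x.
Proof.
move=> Aa bB /silent_notin_slice_word Sa /silent_notin_slice_word Sb ax xb.
have : (k <= k)%N by [].
have oN c j : c \notin slice_word k -> (j < k)%N -> o j != Some c.
  rewrite /slice_word => ck jk; apply: contra ck => /eqP oj.
  by rewrite mem_pmap -oj map_f // mem_iota.
(* The induction is on the number of slices already read, while [a] and [b] remain absent from the
   full word of [k] slices. *)
elim: {1 3 4}k x ax xb => [|j IHj] x ax xb jk.
  by rewrite tau0 e0 /slice_word /word_conf.
have s0 := tau_ge0 j; have st := tau_homo (leqnSn j).
have oa := oN _ _ Sa jk; have ob := oN _ _ Sb jk.
have IH z : a < z -> z <= b -> e (tau j) z = word_conf (slice_word j) z.
  by move=> az zb; apply: IHj => //; exact: ltnW.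
have incr z : A <= z <= B -> n z (tau j.+1) = (n z (tau j) + (o j == Some z))%N.
  exact: increment_slice.
rewrite /slice_word -addn1 iotaD pmap_cat /= add0n -/(slice_word j).
case oj: (o j) => [c|] /=; last first.
  rewrite cats0 -IH // addn1; apply: path_slice_idle => //; rewrite incr ?oj ?addn0 //; lia.
(* Because [c] is neither [a] nor [b], a ring touching a site of [(a, b]] satisfies [a < c < b]. Its
   neighbours [c - 1] and [c + 1] are then in the window and known to be idle. *)
have ac : a != c by apply: contra oa => /eqP ->; rewrite oj.
have bc : b != c by apply: contra ob => /eqP ->; rewrite oj.
have cAB := oAB jk oj.
rewrite cats1 word_conf_rcons addn1.
have nE z : A <= z <= B -> c != z -> n z (tau j.+1) = n z (tau j).
  by move=> zAB cz; rewrite incr // oj (_ : Some c == Some z = false) ?addn0 //; exact: negbTE.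
rewrite /swap_at; have [xc|xc] := eqVneq x c.
  rewrite -!IH; try lia.
  rewrite -(path_slice_swap (c := c) s0 st) /= ?xc //; first by rewrite incr // oj eqxx addn1.
    by apply: nE; lia.
  by apply: nE; lia.
have [xc1|xc1] := eqVneq x (c + 1).
  rewrite -!IH; try lia.
  rewrite -(path_slice_swap (c := c) s0 st) /= ?xc1 //; first by rewrite incr // oj eqxx addn1.
    by apply: nE; lia.
  by apply: nE; lia.
rewrite -IH //; apply: path_slice_idle => //; apply: nE; lia.
Qed.

End TasepPath.

(** * Measurability *)

Section MeasurablePredicates.
Context d (T : measurableType d).
Implicit Types A B : T -> Prop.

Lemma measurable_prop (Q : Prop) : measurable [set _ : T | Q].
Proof.
have [q|nq] := pselect Q.
  by rewrite (_ : mkset _ = setT) //; apply/seteqP; split.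
by rewrite (_ : mkset _ = set0) //; apply/seteqP; split.
Qed.

Lemma measurable_and A B : measurable [set w | A w] -> measurable [set w | B w] ->
  measurable [set w | A w /\ B w].
Proof. exact: measurableI. Qed.

Lemma measurable_or A B : measurable [set w | A w] -> measurable [set w | B w] ->
  measurable [set w | A w \/ B w].
Proof. exact: measurableU. Qed.

Lemma measurable_not A : measurable [set w | A w] -> measurable [set w | ~ A w].
Proof. exact: measurableC. Qed.

Lemma measurable_imp (Q : Prop) A : measurable [set w | A w] ->
  measurable [set w | Q -> A w].
Proof.
move=> mA; have [q|nq] := pselect Q.
  by rewrite (_ : mkset _ = [set w | A w]) //; apply/seteqP; split=> w /=; auto.
by rewrite (_ : mkset _ = setT) //; apply/seteqP; split=> w //= _ /nq.
Qed.

Lemma measurable_exists (I : countType) (F : I -> T -> Prop) :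
  (forall i, measurable [set w | F i w]) -> measurable [set w | exists i, F i w].
Proof.
move=> mF; rewrite (_ : mkset _ = \bigcup_i [set w | F i w]).
  exact: countable_bigcupT_measurable.
by apply/seteqP; split=> w /= [i] => [Fi|_ Fi]; exists i.
Qed.

Lemma measurable_forall (I : countType) (F : I -> T -> Prop) :
  (forall i, measurable [set w | F i w]) -> measurable [set w | forall i, F i w].
Proof.
move=> mF; rewrite (_ : mkset _ = ~` [set w | exists i, ~ F i w]).
  by apply/measurableC/measurable_exists => i; exact: measurable_not.
apply/seteqP; split=> w /= => [Fw [i]|nF i]; first exact.
by apply: contrapT => nFi; apply: nF; exists i.
Qed.

End MeasurablePredicates.

Section EventMeasurability.
Context d (T : measurableType d).
Variable f : T -> int -> int.
Hypothesis mf : forall x z, measurable [set w | f w x = z].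

Lemma measurable_ge x m : measurable [set w | m <= f w x].
Proof.
rewrite (_ : mkset _ = [set w | exists z, f w x = z /\ m <= z]).
  by apply: measurable_exists => z; apply: measurable_and => //; exact: measurable_prop.
by apply/seteqP; split=> w /= => [mfw|[z [->]]//]; exists (f w x).
Qed.

(** Uniqueness makes [xget] independent of any choice, so its value is [p] either through a witness
    or, when [p] is the default 0, through the absence of witnesses. *)
Lemma measurable_xget (A : T -> int -> Prop) (p : int) :
  (forall q, measurable [set w | A w q]) ->
  (forall w q q', A w q -> A w q' -> q = q') ->
  measurable [set w | xget 0 [set q | A w q] = p].
Proof.
move=> mA A1; rewrite (_ : mkset _ =
    [set w | A w p \/ (p = 0 /\ forall q, ~ A w q)]); last first.
  apply/seteqP; split=> w /=.
    by case: xgetP => [q _ Aq <-|nA <-]; [left|right].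
  move=> [Ap|[-> nA]]; case: xgetP => [q _ Aq|nA'] //.
  - exact: A1 Aq Ap.
  - by case: (nA' p).
  - by case: (nA q).
apply: measurable_or => //; apply: measurable_and; first exact: measurable_prop.
by apply: measurable_forall => q; exact: measurable_not.
Qed.

Lemma measurable_left_min b m : measurable [set w | left_min (f w) b = m].
Proof.
apply: measurable_xget => [q|w q q' [[x xb <-] minx] [[x' xb' <-] minx']].
  apply: measurable_and; last first.
    by apply: measurable_forall => x; apply/measurable_imp/measurable_ge.
  rewrite (_ : mkset _ = [set w | exists x, x <= b /\ f w x = q]).
    by apply: measurable_exists => x; apply: measurable_and => //; exact: measurable_prop.
  by apply/seteqP; split=> w /= [x] => [xb fx|[xb fx]]; exists x.
by apply/eqP; rewrite eq_le minx // minx'.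
Qed.

Lemma measurable_position i p : measurable [set w | position (f w) i = p].
Proof.
apply: measurable_xget => [q|w q q' -> /seteqP[+ _]]; last by move=> /(_ q erefl).
rewrite (_ : mkset _ = [set w | f w q = i /\ forall x, x <> q -> ~ f w x = i]).
  apply: measurable_and => //; apply: measurable_forall => x.
  exact/measurable_imp/measurable_not.
apply/seteqP; split=> w /=.
  move=> fq; split; first by have : [set q] q by []; rewrite -fq.
  by move=> x xq fx; apply: xq; have : (f w @^-1` [set i]) x by []; rewrite fq.
move=> [fq nf]; apply/seteqP; split=> x /=; last by move=> ->.
by move=> fx; apply: contrapT => /nf.
Qed.

Lemma measurable_left_min_event r2 r1 y :
  measurable [set w | let nu := left_min (f w) in
    nu r2 = y /\ nu r1 = y /\ nu (r2 - 1) <> y].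
Proof.
apply: measurable_and; first exact: measurable_left_min.
by apply: measurable_and; [|apply: measurable_not]; exact: measurable_left_min.
Qed.

Lemma measurable_leader_event k i p :
  measurable [set w | is_leader (f w) k i /\ position (f w) i = p].
Proof.
apply: measurable_and; last exact: measurable_position.
apply: measurable_and; first exact: measurable_prop.
apply: measurable_forall => z; apply: measurable_imp.
rewrite (_ : mkset _ = [set w | exists q : int * int,
    position (f w) z = q.1 /\ position (f w) i = q.2 /\ q.1 <= q.2]).
  apply: measurable_exists => q; apply: measurable_and; first exact: measurable_position.
  by apply: measurable_and; [exact: measurable_position|exact: measurable_prop].
apply/seteqP; split=> w /=; last by move=> [q [-> [->]]].
by move=> le_pos; exists (position (f w) z, position (f w) i).
Qed.

End EventMeasurability.

(** [A] itself may fail to be measurable. Covers of mass at most [1 / (k + 1)] intersect in a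
    measurable null set that contains it. *)
Lemma small_negligible d (T : measurableType d) (R : realType)
    (P : probability T R) (A : set T) :
  (forall e : R, 0 < e -> exists B, [/\ measurable B, A `<=` B & (P B <= e%:E)%E]) ->
  P.-negligible A.
Proof.
move=> small; have inv_gt0 (k : nat) : 0 < k.+1%:R^-1 :> R by rewrite invr_gt0 ltr0n.
have /choice[B BP] := fun k => small _ (inv_gt0 k).
exists (\bigcap_k B k); split.
- by apply: bigcapT_measurable => k; case: (BP k).
- apply/eqP; rewrite eq_le measure_ge0 andbT.
  apply/lee_addgt0Pr => e e0; rewrite add0e.
  have [k _ /(_ k (leqnn k)) ke] := near_infty_natSinv_lt (PosNum e0).
  have [mB _ PB] := BP k.
  apply: (@le_trans _ _ (P (B k))).
    apply: le_measure; rewrite ?inE //; last by move=> w; exact.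
    by apply: bigcapT_measurable => j; case: (BP j).
  by apply: le_trans PB _; rewrite lee_fin ltW.
by move=> w Aw k _; have [_ + _] := BP k; apply.
Qed.

Lemma expR_neg_pow_small (R : realType) (t e : R) : 0 <= t -> 0 < e ->
  exists L : nat, (1 - expR (- t)) ^+ L <= e.
Proof.
move=> t0 e0; have q0 : 0 <= 1 - expR (- t) by rewrite subr_ge0 expR_le1 oppr_le0.
have q1 : `|1 - expR (- t)| < 1.
  by rewrite ger0_norm // ltrBlDr ltrDl expR_gt0.
have /cvgr0Pnorm_lt /(_ e e0)[L _ /(_ L (leqnn L))] := cvg_expr q1.
by rewrite ger0_norm ?exprn_ge0 // => /ltW; exists L.
Qed.

Lemma bernoulli_ineq (R : realDomainType) (x : R) k : 0 <= x -> x <= 1 ->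
  1 - k%:R * x <= (1 - x) ^+ k.
Proof.
move=> x0 x1; elim: k => [|k IHk]; first by rewrite mul0r subr0.
rewrite exprS; apply: le_trans (ler_wpM2l _ IHk); last by rewrite subr_ge0.
rewrite -natr1; have : 0 <= k%:R * x * x by rewrite !mulr_ge0.
by nra.
Qed.

(** * Probability estimates *)

Lemma probabilityU_le d (T : measurableType d) (R : realType)
    (P : probability T R) (A B : set T) : measurable A -> measurable B ->
  (P (A `|` B) <= P A + P B)%E.
Proof. exact: measureU2. Qed.

Lemma measure_bigsetU_disjoint d (T : measurableType d) (R : realType)
    (P : probability T R) (I : choiceType) (s : seq I) (Q : pred I)
    (F : I -> set T) : uniq s -> (forall i, measurable (F i)) ->
  (forall i j w, F i w -> F j w -> i = j) ->
  P (\big[setU/set0]_(i <- s | Q i) F i) = (\sum_(i <- s | Q i) P (F i))%E.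
Proof.
move=> + mF F1; elim: s => [|i s IHs] /=; first by rewrite !big_nil measure0.
move=> /andP[si /IHs IH]; rewrite !big_cons; case: ifP => // Qi.
have mU : measurable (\big[setU/set0]_(j <- s | Q j) F j) by apply: bigsetU_measurable.
rewrite measureU //; first by congr (_ + _)%E.
apply/seteqP; split=> // w [Fiw]; rewrite -bigcup_seq_cond => -[j /= /andP[js _]].
by move=> /(F1 _ _ _ Fiw) ij; rewrite -ij (negPf si) in js.
Qed.

Lemma le_probability_ae d (T : measurableType d) (R : realType)
    (P : probability T R) (A B : set T) : measurable A -> measurable B ->
  (\forall w \ae P, A w -> B w) -> (P A <= P B)%E.
Proof.
move=> mA mB [Z [mZ PZ AB]].
apply: (@le_trans _ _ (P (B `|` Z))).
  apply: le_measure; rewrite ?inE //; first exact: measurableU.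
  move=> w Aw; have [Zw|nZ] := pselect (Z w); [by right|left].
  by apply: contrapT => nB; apply: nZ; apply: AB => /(_ Aw).
by apply: le_trans (probabilityU_le P mB mZ) _; rewrite PZ adde0.
Qed.

Lemma eq_probability_ae d (T : measurableType d) (R : realType)
    (P : probability T R) (A B : set T) : measurable A -> measurable B ->
  (\forall w \ae P, A w <-> B w) -> P A = P B.
Proof.
move=> mA mB AB; apply/eqP; rewrite eq_le; apply/andP; split;
  by apply: le_probability_ae => //; apply: filterS AB => w [].
Qed.

Lemma sum_option (V : nmodType) (I : finType) (F : option I -> V) :
  \sum_o F o = F None + \sum_i F (Some i).
Proof.
rewrite (bigD1 None) //=; congr (_ + _).
rewrite (reindex_omap Some id) //=; last by case.
by apply: eq_bigl => i; rewrite eqxx.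
Qed.

(** This is the probability that [W] independent clocks ring at most once in total during a time
    [lam]: each clock contributes [expR (- lam)], and the ringing one an extra factor [lam]. *)
Lemma prod_poisson_pmf_sum (R : realType) (lam : R) (W : nat) : 0 < lam ->
  \sum_(o : option 'I_W) \prod_(x < W) poisson_pmf lam (o == Some x) =
  expR (- lam) ^+ W * (1 + W%:R * lam).
Proof.
move=> lam0.
have pmfE (b : bool) : poisson_pmf lam b = expR (- lam) * (if b then lam else 1).
  rewrite /poisson_pmf lam0; case: b; rewrite ?expr1 ?expr0 /= ?invr1.
    by rewrite mulr1 mulrC.
  by rewrite mul1r mulrC.
have prodE (o : option 'I_W) : \prod_(x < W) poisson_pmf lam (o == Some x) =
    expR (- lam) ^+ W * (if o is Some _ then lam else 1).
  under eq_bigr do rewrite pmfE.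
  rewrite big_split /= prodr_const card_ord; congr (_ * _).
  case: o => [i|]; last by rewrite big1.
  rewrite (bigD1 i) //= eqxx big1 ?mulr1 // => j ji.
  by rewrite (_ : Some i == Some j = false) //; apply/eqP => -[ij]; rewrite ij eqxx in ji.
under eq_bigr do rewrite prodE.
rewrite -mulr_sumr sum_option sumr_const card_ord.
by rewrite mulr_natl.
Qed.

(** With [u = W t / (k + 1)], which is at most 1, a slice is good with probability [exp (- u) (1 +
    u) >= (1 - u) (1 + u) = 1 - u ^ 2]. Bernoulli's inequality then loses at most [(k + 1) u ^ 2]
    over all slices. *)
Lemma prod_poisson_pmf_sum_ge (R : realType) (t : R) (W k : nat) : 0 < t ->
  W%:R * t <= k.+1%:R ->
  1 - (W%:R * t) ^+ 2 / k.+1%:R <=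
  (\sum_(o : option 'I_W) \prod_(x < W)
     poisson_pmf (t / k.+1%:R) (o == Some x)) ^+ k.+1.
Proof.
move=> t0 Wt; have k0 : 0 < k.+1%:R :> R by rewrite ltr0n.
rewrite prod_poisson_pmf_sum ?divr_gt0 //; set lam := t / _.
have lam0 : 0 <= lam by rewrite divr_ge0 // ltW.
pose u := W%:R * lam; have u0 : 0 <= u by rewrite mulr_ge0.
have u1 : u <= 1 by rewrite /u /lam mulrA ler_pdivrMr // mul1r.
have uE : (W%:R * t) ^+ 2 / k.+1%:R = k.+1%:R * u ^+ 2.
  by rewrite /u /lam; field; rewrite lt0r_neq0.
rewrite uE; have u2 : u ^+ 2 <= 1 by rewrite expr_le1.
apply: le_trans (bernoulli_ineq k.+1 (sqr_ge0 u) u2) _.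
apply: lerXn2r; rewrite ?nnegrE ?subr_ge0 //.
  by rewrite mulr_ge0 ?exprn_ge0 ?expR_ge0 // addr_ge0.
rewrite -/u -expRM_natl mulrN -/u.
have := expR_ge1Dx (- u); move=> /(ler_wpM2r (addr_ge0 ler01 u0)).
by apply: le_trans; rewrite le_eqVlt; apply/orP; left; apply/eqP; ring.
Qed.

(** * The clocks in a window *)

Lemma map_rev_ord n : [seq rev_ord i | i <- enum 'I_n] = rev (enum 'I_n).
Proof.
apply: (inj_map val_inj); rewrite map_rev val_enum_ord -map_comp.
have -> : [seq val (rev_ord i) | i <- enum 'I_n] =
    [seq (n - j.+1)%N | j <- iota 0 n] by rewrite -val_enum_ord -map_comp.
apply: (@eq_from_nth _ 0%N) => [|i]; rewrite size_map size_iota ?size_rev ?size_iota //.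
move=> lt_in; rewrite nth_rev ?size_iota // (nth_map 0%N) ?size_iota //.
by rewrite !nth_iota //; lia.
Qed.

Lemma pmap_rev (A B : Type) (f : A -> option B) (s : seq A) :
  pmap f (rev s) = rev (pmap f s).
Proof.
elim: s => //= x s IHs; rewrite rev_cons -cats1 pmap_cat IHs /=.
by case: (f x) => [z|] /=; rewrite ?cats0 // rev_cons cats1.
Qed.

Definition window_bond (M : nat) (i : 'I_(M + M).+1) : int := i%:Z - M%:Z.

Lemma window_bond_inj M : injective (@window_bond M).
Proof. by move=> i j /addIr[/ord_inj]. Qed.

Lemma window_bondP M x : reflect (exists i : 'I_(M + M).+1, window_bond i = x)
  (- M%:Z <= x <= M%:Z).
Proof.
apply: (iffP idP) => [xM|[i <-]]; last first.
  by have := ltn_ord i; rewrite /window_bond; lia.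
have iM : (`|(x + M%:Z)%R| < (M + M).+1)%N by lia.
by exists (Ordinal iM); rewrite /window_bond /=; lia.
Qed.

(* [m j] is the bond of the window that rings in the [j]-th slice, if any. *)
Notation slices M k := {ffun 'I_k.+1 -> option 'I_(M + M).+1}.

Definition slice_bond M k (m : slices M k) (j : nat) : option int :=
  if insub j is Some i then omap (@window_bond M) (m i) else None.

Definition rev_slices M k (m : slices M k) : slices M k :=
  [ffun i => m (rev_ord i)].

Definition slices_word M k (m : slices M k) : seq int :=
  slice_word (slice_bond m) k.+1.

Lemma rev_slicesK M k : involutive (@rev_slices M k).
Proof. by move=> m; apply/ffunP => i; rewrite !ffunE rev_ordK. Qed.

Lemma slice_bond_ord M k (m : slices M k) (j : 'I_k.+1) :
  slice_bond m j = omap (@window_bond M) (m j).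
Proof. by rewrite /slice_bond valK. Qed.

Lemma slices_wordE M k (m : slices M k) :
  slices_word m = pmap (fun j => omap (@window_bond M) (m j)) (enum 'I_k.+1).
Proof.
rewrite /slices_word /slice_word -val_enum_ord.
elim: (enum _) => //= j s ->; by rewrite slice_bond_ord.
Qed.

Lemma slices_word_rev M k (m : slices M k) :
  slices_word (rev_slices m) = rev (slices_word m).
Proof.
rewrite !slices_wordE -pmap_rev -map_rev_ord.
by elim: (enum _) => //= j s ->; rewrite ffunE.
Qed.

Section Clocks.
Context d (T : measurableType d) (R : realType) (P : probability T R).
Variable N : int -> R -> {RV P >-> nat}.
Hypothesis clocks : poisson_clocks N.
Variable t : R.
Hypothesis t_gt0 : 0 < t.

Lemma measurable_increment x s u k :
  measurable [set w | (N x u w - N x s w)%N = k].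
Proof.
rewrite (_ : mkset _ = [set w | exists ab : nat * nat,
    N x u w = ab.1 /\ N x s w = ab.2 /\ (ab.1 - ab.2)%N = k]).
  apply: measurable_exists => ab; have mN v a : measurable [set w | N x v w = a].
    by have := @measurable_funPTI _ _ _ _ (N x v) [set a]; apply.
  apply: measurable_and => //; apply: measurable_and => //; exact: measurable_prop.
apply/seteqP; split=> w /=; last by move=> [ab [-> [->]]].
by move=> Nk; exists (N x u w, N x s w).
Qed.

Lemma increment_prob x s u k : 0 <= s -> s < u ->
  P [set w | (N x u w - N x s w)%N = k] = (poisson_pmf (u - s) k)%:E.
Proof. by case: clocks => _ + _; apply. Qed.

Definition all_ring (s : seq int) : set T :=
  [set w | forall x, x \in s -> (N x t w - N x 0 w)%N <> 0%N].

Lemma measurable_all_ring s : measurable (all_ring s).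
Proof.
apply: measurable_forall => x; apply/measurable_imp/measurable_not.
exact: measurable_increment.
Qed.

Lemma all_ring_prob s : uniq s ->
  P (all_ring s) = ((1 - expR (- t)) ^+ size s)%:E.
Proof.
(* Independence is stated for an infinite sequence of times; this one jumps to [t] at once, and only
   its first increment is used. *)
move=> us; pose tau (j : nat) : R := if j is 0%N then 0 else t.
have tau_homo : {homo tau : i j / (i <= j)%N >-> i <= j}.
  by move=> [|i] [|j] //= _; exact: ltW.
have [_ _ /(_ tau (lexx 0) tau_homo) indep] := clocks.
have uF : uniq [seq (x, 0%N) | x <- s] by rewrite map_inj_uniq // => x z [].
have := indep _ (fun=> [set k | k <> 0%N]) uF; rewrite big_map /=.
rewrite (_ : \bigcap_(i in _) _ = all_ring s); last first.
  apply/seteqP; split=> w /= ringw => [x xs|_ /= /mapP[x xs ->]]; last exact: ringw.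
  by apply: (ringw (x, 0%N)); rewrite /= map_f.
move=> ->; rewrite (eq_bigr (fun=> (1 - expR (- t))%:E)) => [|x _].
  by rewrite prodEFin big_const_seq count_predT iter_mulr_1.
rewrite (_ : _ @^-1` _ = ~` [set w | (N x t w - N x 0 w)%N = 0%N]) //.
rewrite probability_setC; last exact: measurable_increment.
by rewrite increment_prob // subr0 /poisson_pmf t_gt0 expr0 invr1 !mul1r.
Qed.

Definition slice_time (k j : nat) : R := j%:R * (t / k.+1%:R).

Lemma slice_time0 k : slice_time k 0 = 0.
Proof. exact: mul0r. Qed.

Lemma slice_time_last k : slice_time k k.+1 = t.
Proof. by rewrite /slice_time mulrC divfK // pnatr_eq0. Qed.

Lemma slice_time_homo k : {homo slice_time k : i j / (i <= j)%N >-> i <= j}.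
Proof.
by move=> i j ij; apply: ler_wpM2r; rewrite ?ler_nat // divr_ge0 // ltW.
Qed.

Definition slices_event M k (m : slices M k) : set T :=
  [set w | forall (j : 'I_k.+1) (i : 'I_(M + M).+1),
     (N (window_bond i) (slice_time k j.+1) w -
      N (window_bond i) (slice_time k j) w)%N = (m j == Some i)].

Lemma slices_event_prob M k (m : slices M k) :
  P (slices_event m) = (\prod_(j < k.+1) \prod_(i < (M + M).+1)
     poisson_pmf (t / k.+1%:R) (m j == Some i))%:E.
Proof.
have [_ _ indep] := clocks.
have tau0 : 0 <= slice_time k 0 by rewrite slice_time0.
pose F : seq (int * nat) := [seq (window_bond i, val j) |
  j <- enum 'I_k.+1, i <- enum 'I_(M + M).+1].
have uF : uniq F.
  apply: allpairs_uniq; rewrite ?enum_uniq // => -[j i] [j' i'] _ _ /= [].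
  by move=> /window_bond_inj -> /ord_inj ->.
pose B (xj : int * nat) := [set (slice_bond m xj.2 == Some xj.1) : nat].
have bondE (j : 'I_k.+1) i : (slice_bond m j == Some (window_bond i)) = (m j == Some i).
  by rewrite slice_bond_ord; case: (m j) => //= i'; rewrite !(inj_eq Some_inj) (inj_eq (@window_bond_inj M)).
have := indep _ tau0 (slice_time_homo k) F B uF.
rewrite (_ : \bigcap_(i in _) _ = slices_event m); last first.
  apply/seteqP; split=> w /= mw.
    move=> j i; have := mw (window_bond i, val j).
    rewrite /B /= bondE; apply; apply/allpairsP.
    by exists (j, i); rewrite !mem_enum.
  move=> _ /= /allpairsP[[j i] [_ _ ->]] /=; rewrite /B /= bondE; exact: mw.
move=> ->; rewrite big_allpairs_dep /= big_enum /= -prodEFin.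
apply: eq_bigr => j _; rewrite big_enum /= -prodEFin; apply: eq_bigr => i _.
rewrite /B /= bondE increment_prob //.
- by congr (poisson_pmf _ _)%:E; rewrite /slice_time -natr1; ring.
- by rewrite -(slice_time0 k) slice_time_homo.
- by rewrite /slice_time -subr_gt0 -natr1 mulrDl mul1r addrC addKr divr_gt0.
Qed.

(** All slices have the same length, so their factors are merely permuted. This is where the
    probabilistic symmetry enters. *)
Lemma slices_event_rev_prob M k (m : slices M k) :
  P (slices_event (rev_slices m)) = P (slices_event m).
Proof.
rewrite !slices_event_prob (reindex_inj rev_ord_inj) /=; congr (_)%:E.
by apply: eq_bigr => j _; apply: eq_bigr => i _; rewrite ffunE rev_ordK.
Qed.

Lemma measurable_slices_event M k (m : slices M k) : measurable (slices_event m).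
Proof.
apply: measurable_forall => j; apply: measurable_forall => i.
exact: measurable_increment.
Qed.

Lemma slices_event_inj M k (m m' : slices M k) w :
  slices_event m w -> slices_event m' w -> m = m'.
Proof.
move=> mw m'w; apply/ffunP => j.
have eqm i : (m j == Some i) = (m' j == Some i).
  by have := mw j i; rewrite m'w; do 2 case: eqP.
case mj: (m j) => [i|]; first by have := eqm i; rewrite mj eqxx => /esym/eqP.
by case m'j: (m' j) => [i|] //; have := eqm i; rewrite mj m'j eqxx.
Qed.

Definition sparse_event M k : set T :=
  \big[setU/set0]_(m : slices M k) slices_event m.

Lemma sparse_event_prob M k : (M + M).+1%:R * t <= k.+1%:R ->
  (P (~` sparse_event M k) <= (((M + M).+1%:R * t) ^+ 2 / k.+1%:R)%:E)%E.
Proof.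
move=> /(prod_poisson_pmf_sum_ge t_gt0) ge.
have mU : measurable (sparse_event M k).
  by apply: bigsetU_measurable => m _; exact: measurable_slices_event.
rewrite probability_setC // /sparse_event measure_bigsetU_disjoint //.
- under eq_bigr do rewrite slices_event_prob.
  rewrite sumEFin -EFinB lee_fin lerBlDr -lerBlDl; apply: le_trans ge _.
  (* Choosing [m] means choosing an outcome in each slice independently, so the sum over [m] factors
     into [k.+1] equal sums. *)
  rewrite -(bigA_distr_bigA (fun=> fun o : option 'I_(M + M).+1 =>
    \prod_(i < (M + M).+1) poisson_pmf (t / k.+1%:R) (o == Some i))).
  by rewrite prodr_const card_ord.
- exact: index_enum_uniq.
- exact: measurable_slices_event.
- exact: slices_event_inj.
Qed.

End Clocks.
(** * Almost sure block structure *)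

Record regular_path (R : realType) (n : int -> R -> nat) (e : R -> int -> int) :
    Prop := RegularPath {
  count_homo : forall x s t, 0 <= s -> s <= t -> (n x s <= n x t)%N;
  count_rcont : forall x s, 0 <= s -> \forall u \near s^'+, n x u = n x s;
  path_tasep : tasep_path n e;
  path_init : forall x, e 0 x = - x }.

Section Tasep.
Context d (T : measurableType d) (R : realType) (P : probability T R).
Variables (N : int -> R -> {RV P >-> nat}) (eta : R -> int -> {RV P >-> int}).
Hypothesis eta_tasep : multitype_tasep N eta.
Hypothesis eta_init : \forall w \ae P, forall x : int, eta 0 x w = - x.

Let clocks : poisson_clocks N := eta_tasep.1.

Let regular w := regular_path (fun x s => N x s w) (fun s x => eta s x w).

Lemma ae_regular : \forall w \ae P, regular w.
Proof.
have [aeN _ _] := clocks; have [_ aepath] := eta_tasep.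
apply: filterS3 aeN aepath eta_init => w Nw ew e0; split=> // x s.
  by move=> u s0 su; have [_ + _] := Nw x; apply.
by move=> s0; have [_ _] := Nw x; apply.
Qed.

Section Time.
Variables (t : R) (t_gt0 : 0 < t).

Definition silent w : set int := [set x | N x t w = N x 0 w].

(** Subtraction in [nat] is truncated, so a zero difference gives equality only because the counts
    are monotone on regular paths. *)
Lemma silentP w x : regular w -> silent w x <-> (N x t w - N x 0 w)%N = 0%N.
Proof.
move=> rw; have := count_homo rw x (lexx 0) (ltW t_gt0).
move=> /= le_N; split=> [->|/eqP]; first by rewrite subnn.
by rewrite subn_eq0 => ge_N; apply/eqP; rewrite eqn_leq ge_N.
Qed.

Section Slices.
Variables (M k : nat) (m : slices M k) (w : T).
Hypotheses (rw : regular w) (mw : slices_event N t m w).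

Let bond_in j c : (j < k.+1)%N -> slice_bond m j = Some c ->
  - M%:Z <= c <= M%:Z.
Proof.
move=> jk; rewrite (slice_bond_ord m (Ordinal jk)).
by case: (m _) => [i [<-]|] //; apply/window_bondP; exists i.
Qed.

Let incr j x : (j < k.+1)%N -> - M%:Z <= x <= M%:Z ->
  (N x (slice_time t k j.+1) w - N x (slice_time t k j) w)%N =
  (slice_bond m j == Some x).
Proof.
move=> jk /window_bondP[i <-]; rewrite (slice_bond_ord m (Ordinal jk)).
rewrite (mw (Ordinal jk) i) /=; case: (m _) => //= i'.
by rewrite !(inj_eq Some_inj) (inj_eq (@window_bond_inj M)).
Qed.

Let tau_homo := slice_time_homo t_gt0 k.

Lemma silent_notin_word c : silent w c -> c \notin slices_word m.
Proof.
move=> Sc; apply: (silent_notin_slice_word (count_homo rw)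
  (slice_time0 t k) tau_homo bond_in incr).
by rewrite slice_time_last.
Qed.

(** Inside the window the word records every ring, so silence can be read off the word, a property
    that survives its reversal. *)
Lemma notin_word_silent c : - M%:Z <= c <= M%:Z -> c \notin slices_word m ->
  silent w c.
Proof.
move=> cM cm; rewrite /silent /= -{1}(slice_time_last t k) -(slice_time0 t k).
have : (k.+1 <= k.+1)%N by [].
elim: {1 3}k.+1 => // j IHj jk; rewrite -IHj; last exact: ltnW.
rewrite (increment_slice (count_homo rw)
  (slice_time0 t k) tau_homo incr) //.
case: eqP => [bj|_]; last by rewrite addn0.
move: cm; rewrite /slices_word /slice_word mem_pmap -bj map_f //.
by rewrite mem_iota.
Qed.

Lemma eta_word a b x : - M%:Z <= a -> b <= M%:Z -> silent w a -> silent w b ->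
  a < x -> x <= b -> eta t x w = word_conf (slices_word m) x.
Proof.
move=> Ma bM Sa Sb ax xb; rewrite -{1}(slice_time_last t k).
have := path_slice_word (count_homo rw) (count_rcont rw)
  (path_tasep rw) (slice_time0 t k) tau_homo bond_in incr
  (path_init rw) Ma bM.
by rewrite !slice_time_last; apply.
Qed.

End Slices.

Lemma ae_silent_seq (s : nat -> int) : injective s ->
  \forall w \ae P, exists i, (N (s i) t w - N (s i) 0 w)%N = 0%N.
Proof.
move=> sinj; apply: small_negligible => e e0.
have [L Le] := expR_neg_pow_small (ltW t_gt0) e0.
exists (all_ring N t [seq s i | i <- iota 0 L]); split.
- exact: measurable_all_ring.
- by move=> w /= /forallNP nw _ /mapP[i _ ->]; exact: nw.
rewrite all_ring_prob // ?map_inj_uniq ?iota_uniq //.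
by rewrite size_map size_iota lee_fin.
Qed.

Lemma sparse_event_small M (e : R) : 0 < e ->
  exists k, (P (~` sparse_event N t M k) <= e%:E)%E.
Proof.
move=> e0; pose u := (M + M).+1%:R * t.
have u0 : 0 <= u by rewrite mulr_ge0 // ltW.
(* The summand [u] meets the hypothesis [u <= k + 1] of the estimate, and the summand [u ^ 2 / e]
   brings the bound [u ^ 2 / (k + 1)] below [e]. *)
pose k := Num.truncn (u + u ^+ 2 / e); have uk : u + u ^+ 2 / e < k.+1%:R.
  exact: truncnS_gt.
have u2e : 0 <= u ^+ 2 / e by rewrite divr_ge0 ?exprn_ge0 // ltW.
exists k; apply: le_trans.
  apply: sparse_event_prob => //; apply: le_trans (ltW uk).
  by rewrite lerDl.
rewrite lee_fin ler_pdivrMr ?ltr0n // -/u mulrC -ler_pdivrMr //.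
by apply: le_trans (ltW uk); rewrite lerDr.
Qed.

Lemma measurable_sparse_event M k : measurable (sparse_event N t M k).
Proof. by apply: bigsetU_measurable => m _; exact: measurable_slices_event. Qed.

Lemma sparse_eventP M k w : sparse_event N t M k w ->
  exists m : slices M k, slices_event N t m w.
Proof. by rewrite /sparse_event -bigcup_seq => -[m _ mw]; exists m. Qed.

Lemma ae_sparse M : \forall w \ae P, exists k (m : slices M k), slices_event N t m w.
Proof.
apply: small_negligible => e /(sparse_event_small M)[k ke].
exists (~` sparse_event N t M k); split=> //.
  exact/measurableC/measurable_sparse_event.
by move=> w /= nw /sparse_eventP[m mw]; apply: nw; exists k, m.
Qed.

Lemma ae_block_conf : \forall w \ae P, block_conf (silent w) (fun x => eta t x w).
Proof.
have aeL : \forall w \ae P, forall K : nat, exists i : nat,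
    (N (- (K + i).+1%:Z)%R t w - N (- (K + i).+1%:Z)%R 0 w)%N = 0%N.
  apply: ae_foralln => K; apply: (@ae_silent_seq (fun i => - (K + i).+1%:Z)).
  by move=> i j /oppr_inj; lia.
have aeR : \forall w \ae P, forall K : nat, exists i : nat,
    (N (K + i).+1%:Z t w - N (K + i).+1%:Z 0 w)%N = 0%N.
  apply: ae_foralln => K; apply: (@ae_silent_seq (fun i => (K + i).+1%:Z)).
  by move=> i j; lia.
have aeS : \forall w \ae P, forall M : nat,
    exists k (m : slices M k), slices_event N t m w.
  by apply: ae_foralln => M; exact: ae_sparse.
have aeLR : \forall w \ae P, regular w /\ (forall K : nat, exists i : nat,
    (N (- (K + i).+1%:Z)%R t w - N (- (K + i).+1%:Z)%R 0 w)%N = 0%N).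
  by apply: filterS2 ae_regular aeL => w; split.
apply: filterS3 aeLR aeR aeS => w [rw Lw] Rw Sw; split=> [K|K|a b Sa Sb ab].
- have [i Si] := Lw `|K|%N; exists (- (`|K| + i).+1%:Z); last exact/silentP.
  by lia.
- have [i Si] := Rw `|K|%N; exists (`|K| + i).+1%:Z; last exact/silentP.
  by lia.
have [k [m mw]] := Sw (`|a| + `|b|)%N.
exists (slices_word m) => [c|x ax xb]; first exact: silent_notin_word.
by apply: (eta_word rw mw (a := a) (b := b)) => //; lia.
Qed.

End Time.
End Tasep.
(** * Comparison of the two events *)

Section Comparison.
Context d (T : measurableType d) (R : realType) (P : probability T R).
Variables (N : int -> R -> {RV P >-> nat}) (eta : R -> int -> {RV P >-> int}).
Hypothesis eta_tasep : multitype_tasep N eta.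
Hypothesis eta_init : \forall w \ae P, forall x : int, eta 0 x w = - x.
Variables (t : R) (t_gt0 : 0 < t) (K L k : nat).

(** The window consists of the core [[-K, K]] and of [L] bonds on each side, among which silent ones
    are sought. *)
Let M := (K + L)%N.
Let lefts : seq int := [seq - (K + i).+1%:Z | i <- iota 0 L].
Let rights : seq int := [seq (K + i).+1%:Z | i <- iota 0 L].
Let event (m : slices M k) := slices_event N t m.
Let word (m : slices M k) := slices_word m.

(* The window contains silent bonds on both sides of [-K, K]. *)
Let separated (m : slices M k) : bool :=
  has (fun x => x \notin word m) lefts && has (fun x => x \notin word m) rights.

Let separated_event : set T :=
  \big[setU/set0]_(m : slices M k | separated m) event m.

Let exceptional : set T := ~` sparse_event N t M k `|`
  (all_ring N t lefts `|` all_ring N t rights).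

Let mem_lefts a : a \in lefts -> - M%:Z <= a /\ a < - K%:Z.
Proof. by case/mapP=> i; rewrite mem_iota /M => iL ->; lia. Qed.

Let mem_rights b : b \in rights -> b <= M%:Z /\ K%:Z < b.
Proof. by case/mapP=> i; rewrite mem_iota /M => iL ->; lia. Qed.

Let clocks : poisson_clocks N := eta_tasep.1.

Lemma measurable_separated_event : measurable separated_event.
Proof. by apply: bigsetU_measurable => m _; exact: measurable_slices_event. Qed.

Lemma measurable_exceptional : measurable exceptional.
Proof.
apply: measurableU; first exact/measurableC/measurable_sparse_event.
by apply: measurableU; exact: measurable_all_ring.
Qed.

Lemma exceptional_prob (e : R) :
  (P (~` sparse_event N t M k) <= e%:E)%E ->
  (1 - expR (- t)) ^+ L <= e -> (P exceptional <= (e + (e + e))%:E)%E.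
Proof.
move=> Se Le; have mall s := measurable_all_ring N t s.
have mS := measurableC (measurable_sparse_event N t M k).
rewrite 2!EFinD; apply: le_trans (probabilityU_le P mS (measurableU _ _ (mall _) (mall _))) _.
apply: leeD => //; apply: le_trans (probabilityU_le P (mall _) (mall _)) _.
apply: leeD; rewrite all_ring_prob ?size_map ?size_iota ?lee_fin //;
  rewrite map_inj_uniq ?iota_uniq // => i j; lia.
Qed.

Lemma ae_separated_or_exceptional :
  \forall w \ae P, separated_event w \/ exceptional w.
Proof.
apply: filterS (ae_regular eta_tasep eta_init) => w rw.
have [Sw|nS] := pselect (sparse_event N t M k w); last by right; left.
have [m mw] := sparse_eventP Sw.
have ringing s : ~~ has (fun x => x \notin word m) s -> all_ring N t s w.
  move=> /hasPn sm x xs; apply/(silentP t_gt0 _ rw).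
  by move=> /(silent_notin_word t_gt0 rw mw); exact/negP/sm.
case sep: (separated m).
  by left; rewrite /separated_event -bigcup_seq_cond; exists m; rewrite //= mem_index_enum.
right; right; move/negbT: sep; rewrite negb_and => /orP[] /ringing; by [left|right].
Qed.

Lemma le_separated_prob (A : set T) (e : R) : measurable A ->
  (P exceptional <= e%:E)%E -> (P A <= P (separated_event `&` A) + e%:E)%E.
Proof.
move=> mA Ve; have mV := measurable_exceptional.
have mUA := measurableI _ _ measurable_separated_event mA.
apply: (@le_trans _ _ (P ((separated_event `&` A) `|` exceptional))).
  apply: le_probability_ae => //; first exact: measurableU.
  by apply: filterS ae_separated_or_exceptional => w [Uw|Vw] Aw; [left|right].
by apply: le_trans (probabilityU_le P mUA mV) _; exact: leeD2l.
Qed.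

(** The events [event m] are disjoint, and on each of them the word decides [A] almost surely, so
    each contributes all of its mass or nothing. *)
Lemma separated_prob (A : set T) (Q : (int -> int) -> Prop) : measurable A ->
  (forall m, separated m ->
     \forall w \ae P, event m w -> (A w <-> Q (word_conf (word m)))) ->
  P (separated_event `&` A) =
  (\sum_(m : slices M k | separated m)
     if `[< Q (word_conf (word m)) >] then P (event m) else 0)%E.
Proof.
move=> mA AQ; have mE m : measurable (event m) by exact: measurable_slices_event.
rewrite /separated_event big_distrl /= measure_bigsetU_disjoint.
- apply: eq_bigr => m sm; case: asboolP => Qm.
    apply: eq_probability_ae => //; first exact: measurableI.
    by apply: filterS (AQ m sm) => w AQw; split=> [[]//|mw]; split=> //; exact/AQw.
  rewrite -(measure0 P); apply: eq_probability_ae => //; first exact: measurableI.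
  by apply: filterS (AQ m sm) => w AQw; split=> // -[mw /AQw] /(_ mw).
- exact: index_enum_uniq.
- by move=> m; exact: measurableI.
by move=> m m' w [mw _] [m'w _]; exact: slices_event_inj mw m'w.
Qed.

Variables (y r1 r2 : int).
Hypotheses (le_r2_r1 : r2 <= r1) (r1K : `|r1| < K%:Z) (r2K : `|r2| < K%:Z).
Hypothesis yK : `|y| < K%:Z.

Lemma separated_words m : separated m -> \forall w \ae P, event m w ->
  exists a b, [/\ a < - K%:Z, K%:Z < b,
    silent N t w a /\ a \notin word m, silent N t w b /\ b \notin word m &
    forall x, a < x -> x <= b -> eta t x w = word_conf (word m) x].
Proof.
move=> /andP[/hasP[a /mem_lefts[Ma aK] am] /hasP[b /mem_rights[bM bK] bm]].
apply: filterS (ae_regular eta_tasep eta_init) => w rw mw.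
have Sa : silent N t w a.
  by apply: (notin_word_silent t_gt0 rw mw) => //; lia.
have Sb : silent N t w b.
  by apply: (notin_word_silent t_gt0 rw mw) => //; lia.
exists a, b; split=> // x ax xb.
exact: (eta_word t_gt0 rw mw (a := a) (b := b)).
Qed.

Let min_set : set T := [set w | let nu := left_min (fun x => eta t x w) in
  nu r2 = y /\ nu r1 = y /\ nu (r2 - 1) <> y].

Let leader_set : set T := [set w | let eta_t := fun x => eta t x w in
  is_leader eta_t (- r1) (- r2) /\ position eta_t (- r2) = - y].

Let measurable_eta x z : measurable [set w | eta t x w = z].
Proof. by have := @measurable_funPTI _ _ _ _ (eta t x) [set z]; apply. Qed.

Let measurable_min_set : measurable min_set.
Proof. exact: (@measurable_left_min_event _ _ (fun w x => eta t x w)). Qed.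

Let measurable_leader_set : measurable leader_set.
Proof. exact: (@measurable_leader_event _ _ (fun w x => eta t x w)). Qed.

Lemma separated_min_leader_prob :
  P (separated_event `&` min_set) = P (separated_event `&` leader_set).
Proof.
have aeB := ae_block_conf eta_tasep eta_init t_gt0.
rewrite [LHS](separated_prob (Q := min_event r2 r1 y) measurable_min_set); last first.
  move=> m /separated_words; apply: filterS2 aeB => w wB + mw.
  move=> /(_ mw)[a [b [aK bK [Sa am] [Sb bm] wE]]].
  apply: (iff_trans (block_conf_min_event y wB le_r2_r1)).
  by apply: (min_event_word wB Sa am bm wE) => //; lia.
rewrite [RHS](separated_prob (Q := leader_event r2 r1 y) measurable_leader_set); last first.
  move=> m /separated_words; apply: filterS2 aeB => w wB + mw.
  move=> /(_ mw)[a [b [aK bK [Sa am] [Sb bm] wE]]].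
  apply: (iff_trans (block_conf_leader_event y wB le_r2_r1)).
  by apply: (leader_event_word wB Sb am bm wE) => //; lia.
(* Reversing the slices preserves the set of letters, hence [separated], and the probability of each
   term, while [min_event_rev] exchanges the two conditions. *)
rewrite [RHS](reindex_inj (inv_inj (@rev_slicesK M k))) /=.
apply: eq_big => m; rewrite /separated /word slices_word_rev.
  by congr (_ && _); apply: eq_has => x; rewrite mem_rev.
move=> _; rewrite /event slices_event_rev_prob //.
by rewrite (propext (min_event_rev _ _ _ _)).
Qed.

Lemma min_leader_prob_close (e : R) :
  (P (~` sparse_event N t M k) <= e%:E)%E ->
  (1 - expR (- t)) ^+ L <= e ->
  (P min_set <= P leader_set + (e + (e + e))%:E)%E /\
  (P leader_set <= P min_set + (e + (e + e))%:E)%E.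
Proof.
move=> Se Le; have Ve := exceptional_prob Se Le.
have close A B : measurable A -> measurable B ->
    P (separated_event `&` A) = P (separated_event `&` B) ->
    (P A <= P B + (e + (e + e))%:E)%E.
  move=> mA mB AB; apply: le_trans (le_separated_prob mA Ve) _.
  rewrite AB; apply: leeD2r; apply: le_measure; rewrite ?inE //.
  exact: measurableI measurable_separated_event mB.
by split; apply: close => //; rewrite separated_min_leader_prob.
Qed.

End Comparison.

Lemma block_conf_id : block_conf setT (fun x => - x).
Proof.
split=> [K|K|a b _ _ _]; [exists (K - 1)|exists (K + 1)|exists [::]] => //; lia.
Qed.

Unset Implicit Arguments.

(* The signs on the right-hand side are needed for the orientation conventions
   in force (larger types move to the right, the leader is the right-most
   particle): the law of eta_t is invariant under inversion and under
   x |-> - eta_t (- x), and it is the composition of the two that exchanges the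
   two events. *)
Theorem proposition6p5 (d : measure_display) (T : measurableType d)
    (R : realType) (P : probability T R)
    (N : int -> R -> {RV P >-> nat}) (eta : R -> int -> {RV P >-> int})
    (eta_tasep : multitype_tasep N eta)
    (eta_init : \forall w \ae P, forall x : int, eta 0 x w = - x)
    (t : R) (t_ge0 : 0 <= t) (y r1 r2 : int) (le_r2_r1 : r2 <= r1) :
  P [set w | let nu := left_min (fun x => eta t x w) in
             nu r2 = y /\ nu r1 = y /\ nu (r2 - 1) <> y] =
  P [set w | let eta_t := fun x => eta t x w in
             is_leader eta_t (- r1) (- r2) /\
             position eta_t (- r2) = - y].
Proof.
have measurable_eta x z : measurable [set w | eta t x w = z].
  by have := @measurable_funPTI _ _ _ _ (eta t x) [set z]; apply.
(* At time 0 the slices degenerate. The configuration is then that of the empty word with every bond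
   silent, and the empty word is its own reversal. *)
move: t_ge0; rewrite le_eqVlt => /orP[/eqP t0|t_gt0].
  apply: eq_probability_ae.
  - exact: (@measurable_left_min_event _ _ (fun w x => eta t x w)).
  - exact: (@measurable_leader_event _ _ (fun w x => eta t x w)).
  apply: filterS eta_init => w w0 /=; rewrite -t0.
  have -> : (fun x => eta 0 x w) = (fun x => - x) by apply/funext.
  apply: (iff_trans (block_conf_min_event y block_conf_id le_r2_r1)).
  apply: iff_sym.
  apply: (iff_trans (block_conf_leader_event y block_conf_id le_r2_r1)).
  exact: iff_sym (min_event_rev [::] r2 r1 y).
(* The successor makes the three bounds by [K] strict. *)
pose K := (`|r1| + `|r2| + `|y|).+1%N.
set A := (X in P X = _); set B := (X in _ = P X).
have close (e : R) : 0 < e ->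
    (P A <= P B + e%:E)%E /\ (P B <= P A + e%:E)%E.
  move=> e0; have e30 : 0 < e / 3 by rewrite divr_gt0.
  (* The order matters: [L] fixes the window, and the number of slices is then chosen for that
     window. The three thirds of [e] pay for the crowded slices and for the missing silent bonds on
     either side. *)
  have [L Le] := expR_neg_pow_small (ltW t_gt0) e30.
  have [k ke] := sparse_event_small eta_tasep t_gt0 (K + L) e30.
  have -> : e = e / 3 + (e / 3 + e / 3) by lra.
  by apply: (min_leader_prob_close eta_tasep eta_init t_gt0 le_r2_r1 _ _ _ ke Le); lia.
by apply/eqP; rewrite eq_le; apply/andP; split; apply/lee_addgt0Pr => e /close[].
Qed.
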